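(* Let $(X,d)$ be a compact metric space, let $(x_i)_{i\ge1}$ and $(x'_i)_{i\ge1}$ be two sequences in $X$, and fix a fast growing sequence $(p_i)_{i\ge0}$. Let $z=z((p_i),(x_i))$ and $z'=z((p_i),(x'_i))$ be the associated Oxtoby sequences, and assume that $z$ and $z'$ are non-periodic. Then the following are equivalent: (1) the Oxtoby systems $(\overline O(z),S)$ and $(\overline O(z'),S)$ are conjugate; (2) $(x_i)$ and $(x'_i)$ have the same topological type.
   Context: $S$ is the left shift on $X^{\mathbb Z}$, $S(x)(n)=x(n+1)$, and $\overline O(z)$ is the closure of $\{S^nz:n\in\mathbb Z\}$ in $X^{\mathbb Z}$. A sequence $z\in X^{\mathbb Z}$ is non-periodic if $S^nz\ne z$ for all $n\neq 0$. Systems $(A,S)$, $(B,S)$ are conjugate if there is a homeomorphism $h:A\to B$ with $h\circ S=S\circ h$. Two sequences $(x_n)$, $(x_n')$ have the same topological type if for every increasing sequence of natural numbers $(n_k)$, $(x_{n_k})$ converges iff $(x'_{n_k})$ converges. A sequence of natural numbers $(p_i)_{i\ge0}$ is fast growing if $p_0=1$, $p_i\mid p_{i+1}$ and $p_{i+1}/p_i\ge 3$ for all $i\ge0$. Given a fast growing sequence $(p_i)$ and a sequence $(x_i)_{i\ge1}$ in $X$, the Oxtoby sequence $z=z((p_i),(x_i))\in X^{\mathbb Z}$ is defined inductively: in step $1$ set $z(n)=x_1$ for all $n\equiv-1$ or $0\pmod{p_1}$. For $i\ge1$ and $k\in\mathbb Z$ let $J(i,k)$ be the set of $n\in[kp_i,(k+1)p_i)$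 for which $z(n)$ is not yet defined at the end of step $i$; in step $i+1$ set $z(n)=x_{i+1}$ for all $n\in J(i,k)$ with $k\equiv-1$ or $0\pmod{p_{i+1}/p_i}$. This defines $z(n)$ for all $n\in\mathbb Z$. The Oxtoby system is $(\overline O(z),S)$. *)

(* Defs.v *)
From HB Require Import structures.
From mathcomp Require Import all_boot all_order all_algebra.
From mathcomp Require Import all_classical all_reals all_analysis.
From mathcomp Require Import zify.

Set Implicit Arguments.
Unset Strict Implicit.
Unset Printing Implicit Defensive.

Import Order.TTheory GRing.Theory Num.Theory.
Local Open Scope classical_set_scope.
Local Open Scope ring_scope.

Section Shift.
Variable X : topologicalType.
Implicit Types z x : {ptws int -> X}.

Definition left_shift z : {ptws int -> X} := fun n => z (n + 1).

(* The iterate S^m for m : int, in closed form; [left_shiftz0] and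
   [left_shiftzS] characterize it. *)
Definition left_shiftz (m : int) z : {ptws int -> X} := fun n => z (n + m).

Lemma left_shiftz0 z : left_shiftz 0 z = z.
Proof. by apply: funext => n; rewrite /left_shiftz addr0. Qed.

Lemma left_shiftzS m z : left_shiftz (m + 1) z = left_shift (left_shiftz m z).
Proof.
by apply: funext => n; rewrite /left_shiftz /left_shift addrAC addrA.
Qed.

Definition non_periodic z := forall m : int, m != 0 -> left_shiftz m z <> z.

Definition orbit_closure z : set {ptws int -> X} :=
  closure (range (left_shiftz ^~ z)).

Lemma continuous_left_shift : continuous left_shift.
Proof.
move=> z; have Fz : Filter (left_shift @ z).
  exact/fmap_filter/(@nbhs_filter {ptws int -> X}).
apply/cvg_sup => i.
apply/(@cvg_image _ _ (fun f : int -> X => f i) _ _ Fz).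
  by rewrite eqEsubset; split => // y _; exists (fun=> y).
move=> A /= nA; exists [set g : {ptws int -> X} | A (g i)].
  exact: (@proj_continuous int (fun=> X) (i + 1) z A nA).
rewrite eqEsubset; split => [y [f Af <-]//|y Ay].
by exists (fun=> y).
Qed.

Lemma orbit_closure_left_shift z x :
  orbit_closure z x -> orbit_closure z (left_shift x).
Proof.
move=> zx B /continuous_left_shift /zx[_ /= [[m _ <-] Bm]].
by exists (left_shift (left_shiftz m z)); split=> //; exists (m + 1) => //;
  rewrite left_shiftzS.
Qed.

(* The domain and codomain are the subtype of the points of the orbit closure,
   with the subspace topology. *)
Definition orbit_closure_shift z (x : orbit_closure z) : orbit_closure z :=
  SigSub (mem_set (orbit_closure_left_shift (set_valP x))).

End Shift.

Definition homeomorphism (T U : topologicalType) (h : T -> U) :=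
  continuous h /\
  exists k : U -> T, [/\ cancel h k, cancel k h & continuous k].

Definition conjugate (T U : topologicalType) (f : T -> T) (g : U -> U) :=
  exists h : T -> U, homeomorphism h /\ h \o f =1 g \o h.

Definition same_topological_type (T : topologicalType) (x x' : nat -> T) :=
  forall u : nat -> nat, increasing_seq u ->
    (exists l : T, x \o u @ \oo --> l) <->
    (exists l : T, x' \o u @ \oo --> l).

Definition fast_growing (p : nat -> nat) :=
  [/\ p 0%N = 1%N, forall i, (p i %| p i.+1)%N &
      forall i, (3 <= p i.+1 %/ p i)%N].

Section Oxtoby.
Variables (X : topologicalType) (p : nat -> nat) (x : nat -> X).

(* [oxtoby_step i n] is the value at n at the end of step i, [None] if
   undefined.  Sequences (x_i)_{i >= 1} are indexed from 0: [x i] is x_{i+1}.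
   Step i.+1 fills the undefined places of the k-th block of length p_i, i.e.
   those n with k = n div p_i, when k = -1, 0 modulo p_{i+1}/p_i; as p_0 = 1,
   this includes step 1. *)
Fixpoint oxtoby_step (i : nat) (n : int) : option X :=
  if i is j.+1 then
    if oxtoby_step j n is Some a then Some a else
    let k := (n %/ p j)%Z in
    let q := (p j.+1 %/ p j)%N in
    if (k == -1 %[mod q])%Z || (k == 0 %[mod q])%Z then Some (x j) else None
  else None.

(* When p is fast growing every place gets filled ([oxtobyP]), so that the
   default value [x 0] plays no role. *)
Definition oxtoby : {ptws int -> X} :=
  fun n => xget (x 0%N) [set a | exists i, oxtoby_step i n = Some a].

Lemma oxtoby_step_le i j n a :
  (i <= j)%N -> oxtoby_step i n = Some a -> oxtoby_step j n = Some a.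
Proof.
move=> /subnK <-; elim: (j - i)%N => [//|k IH] /IH {}IH.
by rewrite addSn /= IH.
Qed.

Lemma fast_growing_gt i : fast_growing p -> (i < p i)%N.
Proof.
case=> p0 pd p3; elim: i => [|i IH]; first by rewrite p0.
have := p3 i; have /divnK := pd i; set q := (_ %/ _)%N => <-; nia.
Qed.

Lemma oxtobyP n : fast_growing p ->
  exists i, oxtoby_step i n = Some (oxtoby n).
Proof.
move=> pfast; suff [i [a ia]] : exists i a, oxtoby_step i n = Some a.
  have [|j ja] := @xgetPex _ (x 0%N) [set b | exists i, oxtoby_step i n = Some b].
    by exists a, i.
  by exists j.
exists `|n|.+1%N; rewrite /=; case: oxtoby_step => [a|]; first by exists a.
have lt_n := fast_growing_gt `|n|%N pfast.
case: ifP => [_|/negP[]]; first by exists (x `|n|%N).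
have [n0|n0] := leP 0 n.
  by rewrite [X in _ || (X == _ %[mod _])%Z]divz_small ?eqxx ?orbT//; lia.
suff -> : (n %/ p `|n|%N)%Z = -1 by rewrite eqxx.
have pn0 : (p `|n|%N : int) != 0 by lia.
have := divz_eq n (p `|n|%N); have := modz_ge0 n pn0.
have := ltz_mod n pn0; nia.
Qed.

Lemma oxtobyE i n a : oxtoby_step i n = Some a -> oxtoby n = a.
Proof.
move=> ia.
have [|j ja] := @xgetPex _ (x 0%N) [set b | exists i, oxtoby_step i n = Some b].
  by exists a, i.
have := oxtoby_step_le (leq_maxr i j) ja.
by rewrite (oxtoby_step_le (leq_maxl i j) ia) => -[->].
Qed.

End Oxtoby.

(* Main.v *)
Require Import Defs.
From mathcomp Require Import all_boot all_order all_algebra.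
From mathcomp Require Import all_classical all_reals all_analysis.
From mathcomp Require Import zify.

(* The stage [level n] at which a place [n] is filled depends only on [p], and
   z n = x (level n).  A point [w] of the orbit closure of [z] is a limit of
   shifts S^m z along an ultrafilter of integers m, which has a residue [s i]
   modulo each [p i]; this phase [s] determines [w] except at the places
   [n] with [i <= level (s i + n)] for all [i], the holes, where [w] takes a
   single value, a cluster point of [x].

   (2) => (1): if [z] is not periodic, the phase of [w] is unique.  Hence two
   ultrafilters along which S^m z has the same limit have the same residues, and
   along each of them S^m z' is either eventually constant at a place or
   follows [x'] along stages tending to infinity; interleaving two such
   sequences of stages shows that the limits of S^m z' agree.  So the closure
   of the pairs (S^m z, S^m z') is the graph of a conjugacy.

   (1) => (2): let the factor map [k] send [w], of phase [s] over z', to [z].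
   Take integers g i, convergent in the odometer, such that the place g i is
   filled at stage i, so that (S^(g i) z) 0 = x i.  If [s] is an integer, [w] is
   a shift of z' and, along a sequence of stages where [x'] converges,
   S^(g i) w and therefore S^(g i) z converge, and so does [x].  Otherwise [g]
   can be chosen so that the limiting phase s + g has no hole; then S^(g i) w
   converges, and [x] converges. *)

Set Implicit Arguments.
Unset Strict Implicit.
Unset Printing Implicit Defensive.

Import Order.TTheory GRing.Theory Num.Theory.
Local Open Scope classical_set_scope.
Local Open Scope ring_scope.

(** * Arithmetic of the filling stages *)

Definition filled_at (p : nat -> nat) (i : nat) (n : int) :=
  let k := (n %/ p i)%Z in let q := (p i.+1 %/ p i)%N in
  (k == -1 %[mod q])%Z || (k == 0 %[mod q])%Z.

(** [filled_at] disregards earlier stages, so the stage that really fills [n] is the least one. The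
    search can stop at [|n|], because [p |n|] exceeds [|n|]. *)
Definition level (p : nat -> nat) (n : int) : nat :=
  find (fun i => filled_at p i n) (iota 0 `|n|.+1).

Lemma fast_growingS p i : fast_growing p ->
  exists2 q, (3 <= q)%N & (p i.+1 = q * p i)%N.
Proof.
by case=> _ pd p3; exists (p i.+1 %/ p i)%N => //; rewrite divnK.
Qed.

(** Blocks -1 and 0 are adjacent, so stage [i] covers an interval of radius [p i] around each
    multiple of [p i.+1]. *)
Lemma filled_atP p i (n : int) : fast_growing p ->
  reflect (exists a : int, a * (p i.+1)%:Z - (p i)%:Z <= n < a * (p i.+1)%:Z + (p i)%:Z)
          (filled_at p i n).
Proof.
move=> pf; suff : filled_at p i n <->
    exists a : int, a * (p i.+1)%:Z - (p i)%:Z <= n < a * (p i.+1)%:Z + (p i)%:Z.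
  by move=> [f1 f2]; apply: (iffP idP) => [/f1|/f2].
have p0 := leq_ltn_trans (leq0n i) (fast_growing_gt i pf).
have [q q3 Eq] := fast_growingS i pf.
rewrite /filled_at Eq mulnK // PoszM.
have := divz_eq n (p i); have := @modz_ge0 n (p i).
have -> : (p i : int) != 0 by lia.
move=> /(_ isT); have := @ltz_pmod n (p i : int); rewrite ltz_nat => /(_ p0).
set k := (n %/ p i)%Z; set r := (n %% p i)%Z => h1 h2 ->.
rewrite !eqz_mod_dvd subr0 opprK.
split=> [/orP[]/dvdzP[a Ha]|[a]].
- by exists a; have -> : k = a * q - 1; [lia|nia].
- by exists a; rewrite Ha; nia.
case/andP => h3 h4.
have h5 : (a * q - 1) * (p i)%:Z < (k + 1) * (p i)%:Z by nia.
have h6 : k * (p i)%:Z < (a * q + 1) * (p i)%:Z by nia.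
have pZ : 0 < (p i)%:Z by [].
move: h5 h6; rewrite !(ltr_pM2r pZ) => h7 h8.
apply/orP; have [->|kn] := eqVneq k (a * q); first by right; rewrite dvdz_mull.
by left; have -> : k = a * q - 1; [lia | rewrite subrK dvdz_mull].
Qed.

Lemma fast_growing_dvd p i j : fast_growing p -> (i <= j)%N -> (p i %| p j)%N.
Proof.
move=> [_ pd _] /subnK <-; elim: (j - i)%N => // k IH.
by rewrite addSn (dvdn_trans IH).
Qed.

Lemma fast_growing_gt0 p i : fast_growing p -> (0 < p i)%N.
Proof. by move=> pf; apply: leq_ltn_trans (fast_growing_gt i pf). Qed.

Lemma fast_growing_dvdz p i j (d : int) : fast_growing p -> (i <= j)%N ->
  (p j %| d)%Z -> (p i %| d)%Z.
Proof. by move=> pf ij; apply/dvdz_trans/fast_growing_dvd. Qed.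

Lemma filled_at_center p i (n : int) : fast_growing p ->
  - (p i)%:Z <= n < (p i)%:Z -> filled_at p i n.
Proof. by move=> pf n01; apply/filled_atP => //; exists 0; lia. Qed.

Lemma filled_at_hole p i (r k : int) : fast_growing p -> 0 <= r < (p i)%:Z ->
  1 <= k <= (p i.+1 %/ p i)%N%:Z - 2 -> ~~ filled_at p i (r + k * (p i)%:Z).
Proof.
move=> pf r0; have p0 := fast_growing_gt0 i pf.
have [q q3 Eq] := fast_growingS i pf; rewrite Eq mulnK // => kq.
apply/negP => /filled_atP -/(_ pf)[a]; rewrite Eq PoszM mulrA => aP.
have h1 : (a * q - 1) * (p i)%:Z < (k + 1) * (p i)%:Z by lia.
have h2 : k * (p i)%:Z < (a * q + 1) * (p i)%:Z by lia.
have pZ : 0 < (p i)%:Z by [].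
move: h1 h2; rewrite !(ltr_pM2r pZ) => h1 h2.
have [a0|a1] := leP a 0; nia.
Qed.

Lemma filled_at_period p i (n d : int) : fast_growing p ->
  (p i.+1 %| d)%Z -> filled_at p i (n + d) = filled_at p i n.
Proof.
move=> pf /dvdzP[b ->].
by apply/filled_atP/filled_atP => // -[a aP];
  [exists (a - b)|exists (a + b)]; lia.
Qed.

(* A translation by at most [p i] that leaves the interval filled at stage
   [i.+1] lands within [p i] of a multiple of [p i.+1], filled at stage [i]. *)
Lemma filled_at_near p i (m n : int) : fast_growing p -> `|n| <= (p i)%:Z ->
  filled_at p i.+1 m -> filled_at p i (m + n) || filled_at p i.+1 (m + n).
Proof.
move=> pf np /(filled_atP _ _ pf)[a]; have [q _ Eq] := fast_growingS i.+1 pf.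
set P2 := p i.+2 in Eq *; set P1 := p i.+1 in Eq * => am.
have [h1|h1] := leP (a * P2%:Z + P1%:Z) (m + n).
  apply/orP; left; apply/filled_atP => //; exists (a * q + 1); rewrite -/P1; nia.
have [h2|h2] := leP (a * P2%:Z - P1%:Z) (m + n).
  by apply/orP; right; apply/filled_atP => //; exists a; rewrite -/P1 -/P2; lia.
apply/orP; left; apply/filled_atP => //; exists (a * q - 1); rewrite -/P1; nia.
Qed.

Lemma filled_at_abs p (n : int) : fast_growing p -> filled_at p `|n|%N n.
Proof.
move=> pf; have := fast_growing_gt `|n|%N pf => ?.
by apply: filled_at_center => //; lia.
Qed.

Lemma level_filled p n : fast_growing p -> filled_at p (level p n) n.
Proof.
move=> pf; have hn : has (fun i => filled_at p i n) (iota 0 `|n|.+1).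
  by apply/hasP; exists `|n|%N; rewrite ?filled_at_abs // mem_iota/=; lia.
have := nth_find 0%N hn; rewrite nth_iota //.
by rewrite has_find size_iota in hn.
Qed.

Lemma level_le p n i : filled_at p i n -> (level p n <= i)%N.
Proof.
move=> fi; rewrite leqNgt; apply/negP => il.
have := before_find 0%N il; rewrite nth_iota ?fi //.
by have := find_size (fun i => filled_at p i n) (iota 0 `|n|.+1);
  rewrite size_iota => /(leq_trans il).
Qed.

Lemma level_lt p n i : fast_growing p -> (i <= level p n)%N ->
  ~~ filled_at p i n -> (i < level p n)%N.
Proof.
move=> pf; rewrite leq_eqVlt => /orP[/eqP ->|//].
by rewrite level_filled.
Qed.

(** Stage [j] is periodic modulo [p j.+1], which divides [p i] when [j < i]. *)
Lemma level_period p i (n d : int) : fast_growing p ->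
  (p i %| d)%Z -> (level p n < i)%N -> level p (n + d) = level p n.
Proof.
move=> pf pd li; apply/eqP; rewrite eqn_leq.
have h1 : (level p (n + d) <= level p n)%N.
  by rewrite level_le // filled_at_period ?level_filled //;
    apply: fast_growing_dvdz pd.
rewrite h1 level_le //.
rewrite -[X in filled_at _ _ X](addrK d) filled_at_period ?level_filled //.
by rewrite rpredN; apply: fast_growing_dvdz pd => //; apply: leq_ltn_trans li.
Qed.

Lemma level_period_ge p i (n d : int) : fast_growing p ->
  (p i %| d)%Z -> (i <= level p n)%N -> (i <= level p (n + d))%N.
Proof.
move=> pf pd il; rewrite leqNgt; apply/negP => h.
have := @level_period _ _ (n + d) (- d) pf _ h.
by rewrite rpredN => /(_ pd); rewrite addrK => e; move: il; rewrite e leqNgt h.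
Qed.

Lemma block_reduce p i (n : int) : fast_growing p ->
  exists k : int, 0 <= n + k * (p i)%:Z < (p i)%:Z.
Proof.
move=> pf; have p0 := fast_growing_gt0 i pf.
exists (- (n %/ p i)%Z).
have := divz_eq n (p i); have := @ltz_pmod n (p i : int).
rewrite ltz_nat => /(_ p0); have := @modz_ge0 n (p i).
have -> : (p i : int) != 0 by lia.
by move=> /(_ isT); lia.
Qed.

(** Induction on [j]: moving by a multiple of [p (m + i)] into block 1, which is neither 0 nor -1
    because the ratios are at least 3, escapes stage [m + i] and keeps all earlier stages
    avoided. *)
Lemma hole_ge p i j (r : int) : fast_growing p -> (i <= j)%N ->
  (i <= level p r)%N -> exists k : int, (j <= level p (r + k * (p i)%:Z))%N.
Proof.
move=> pf /subnK <-; elim: (j - i)%N => [|m IH] ir.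
  by exists 0; rewrite mul0r addr0.
have {IH}[k jk] := IH ir.
have [l lP] := block_reduce (m + i) (r + k * (p i)%:Z) pf.
have /dvdnP[c Ec] := fast_growing_dvd pf (leq_addl m i).
exists (k + (l + 1) * c); rewrite addSn; apply: level_lt => //.
  rewrite mulrDl addrA level_period_ge //.
  by rewrite -mulrA -PoszM -Ec dvdz_mull.
rewrite mulrDl -mulrA -PoszM -Ec addrA mulrDl addrA filled_at_hole //.
by have [q q3 ->] := fast_growingS (m + i) pf; rewrite mulnK ?fast_growing_gt0//; lia.
Qed.

Lemma hole_level p i j (r : int) : fast_growing p -> (i <= j)%N ->
  (i <= level p r)%N -> exists k : int, level p (r + k * (p i)%:Z) = j.
Proof.
move=> pf ij ir; have [k jk] := hole_ge pf ij ir.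
have [l lP] := block_reduce j (r + k * (p i)%:Z) pf.
have /dvdnP[c Ec] := fast_growing_dvd pf ij.
exists (k + l * c); rewrite mulrDl -mulrA -PoszM -Ec addrA.
apply/eqP; rewrite eqn_leq level_period_ge ?dvdz_mull // andbT.
by rewrite level_le // filled_at_center //; lia.
Qed.

(** Write [d = e * p i] and take [r] in block 0 with level [i]. The images of [r] and [r - p i] are
    again filled at stage [i], so both [e] and [e - 1] are 0 or -1 modulo the ratio [q]; as [q] is
    at least 3, [e] is 0 modulo [q]. *)
Lemma level_inj_period p i (d : int) : fast_growing p -> (p i %| d)%Z ->
  (forall n, (level p n <= i)%N -> (level p (n + d) <= i)%N) ->
  (p i.+1 %| d)%Z.
Proof.
move=> pf /dvdzP[e ->] H.
have [k Hk] := @hole_level p 0 i 0 pf (leq0n _) (leq0n _).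
have [l] := block_reduce i (0 + k * p 0%N) pf.
set r := _ + l * _ => r01.
have ir : (i <= level p r)%N by rewrite level_period_ge ?Hk ?dvdz_mull.
have fr m : (p i %| m)%Z -> filled_at p i (r + m) -> filled_at p i (r + m + e * (p i)%:Z).
  move=> pm fm; have lm := H _ (level_le fm).
  have E : level p (r + m + e * (p i)%:Z) = i.
    apply/eqP; rewrite eqn_leq lm /=.
    by rewrite level_period_ge ?dvdz_mull // level_period_ge.
  by have := level_filled (r + m + e * (p i)%:Z) pf; rewrite E.
have p0 := fast_growing_gt0 i pf; have [q q3 Eq] := fast_growingS i pf.
have := fr 0 (dvdz0 _); rewrite addr0 => /(_ _)/(filled_atP _ _ pf)[|a].
  by apply: filled_at_center => //; lia.
have := fr (- (p i)%:Z); rewrite rpredN dvdzz => /(_ isT _)/(filled_atP _ _ pf)[|b].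
  by apply: filled_at_center => //; lia.
rewrite Eq PoszM !mulrA => b12 a12.
have h1 : (a * q - 2) * (p i)%:Z < e * (p i)%:Z by lia.
have h2 : e * (p i)%:Z < (a * q + 1) * (p i)%:Z by lia.
have h3 : (b * q - 1) * (p i)%:Z < e * (p i)%:Z by lia.
have h4 : e * (p i)%:Z < (b * q + 2) * (p i)%:Z by lia.
have pZ : 0 < (p i)%:Z by [].
move: h1 h2 h3 h4; rewrite !(ltr_pM2r pZ) => h1 h2 h3 h4.
suff -> : e = a * q by rewrite -mulrA dvdz_mull.
have [ab|ab] := leP a (b - 1); first by nia.
have [ba|ba] := leP (b + 1) a; first by nia.
have E : a = b by lia.
by rewrite E in h1 h2 *; lia.
Qed.

(* Adding to [c] a multiple of [p i] whose digit is neither 0 nor -1 brings it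
   to digit 0 or -1, unless [c] has digit 0 already. *)
Lemma middle_digit p i (c : int) : fast_growing p ->
  exists k : int, 1 <= k <= (p i.+1 %/ p i)%N%:Z - 2 /\
   (filled_at p i (c + k * (p i)%:Z) \/
    exists b : int, b * (p i.+1)%:Z <= c < b * (p i.+1)%:Z + (p i)%:Z).
Proof.
move=> pf; have p0 := fast_growing_gt0 i pf; have [q q3 Eq] := fast_growingS i pf.
have [l] := block_reduce i.+1 c pf.
set r := c + _ => rP; have [m] := block_reduce i r pf => mP.
have -> : c = r - l * (p i.+1)%:Z by rewrite addrK.
rewrite Eq mulnK // PoszM.
have m1 : - m < q by nia.
have m0 : m <= 0 by nia.
have [m00|mn0] := eqVneq m 0.
  by exists 1; split; [lia|right; exists (- l)]; lia.
have [mq|mq] := eqVneq m (1 - q%:Z).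
  exists 1; split; first lia.
  by left; apply/filled_atP => //; exists (1 - l); rewrite Eq PoszM; nia.
exists (q%:Z - 1 + m); split; first lia.
by left; apply/filled_atP => //; exists (1 - l); rewrite Eq PoszM; nia.
Qed.

(** * Oxtoby sequences, pointwise convergence and ultrafilters of integers *)

Lemma oxtoby_step_None (X : topologicalType) p (x : nat -> X) i n :
  fast_growing p -> (i <= level p n)%N -> oxtoby_step p x i n = None.
Proof.
move=> pf; elim: i => [//|i IH] il /=; rewrite IH 1?ltnW //.
case: ifP => // fi; have : (level p n <= i)%N by apply: level_le; exact: fi.
by rewrite leqNgt il.
Qed.

Lemma oxtoby_level (X : topologicalType) p (x : nat -> X) n :
  fast_growing p -> oxtoby p x n = x (level p n).
Proof.
move=> pf; apply: (@oxtobyE _ _ _ (level p n).+1).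
rewrite /= oxtoby_step_None //; have := level_filled n pf.
by rewrite /filled_at /= => ->.
Qed.

Lemma ptws_cvg (I : Type) (X : topologicalType) (F : set_system I)
    (f : I -> {ptws int -> X}) (l : {ptws int -> X}) :
  Filter F -> (f @ F --> l) <-> (forall n, f i n @[i --> F] --> l n).
Proof.
move=> FF; split=> [fl n|fl].
  by move=> A /(@proj_continuous int (fun=> X) n l) /fl.
apply/cvg_sup => n.
have Ff : Filter (f @ F) by exact: fmap_filter.
apply/(@cvg_image _ _ (fun g : int -> X => g n) _ _ Ff).
  by rewrite eqEsubset; split => // y _; exists (fun=> y).
move=> A /= /fl FA; exists [set g : {ptws int -> X} | A (g n)] => //.
rewrite eqEsubset; split => [y [g Ag <-]//|y Ay].
by exists (fun=> y).
Qed.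

Lemma compact_ptws (X : topologicalType) :
  compact [set: X] -> compact [set: {ptws int -> X}].
Proof.
move=> cX; have := @tychonoff int (fun=> X) (fun=> setT) (fun=> cX).
by congr compact; rewrite eqEsubset.
Qed.

Lemma closure_range_ultra (I : Type) (T : topologicalType) (f : I -> T) a :
  closure (range f) a -> exists2 U : set_system I, UltraFilter U & f @ U --> a.
Proof.
move=> fa; pose F := filter_from (nbhs a) (fun B => f @^-1` B).
have FF : ProperFilter F.
  apply: filter_from_proper => [|B /fa[_ [[i _ <-] Bi]]]; last by exists i.
  apply: filter_from_filter; first by exists setT; exact: filterT.
  by move=> A B aA aB; exists (A `&` B) => //; exact: filterI.
have [U [UU FU]] := ultraFilterLemma FF.
by exists U => // B aB; apply: FU; exists B.
Qed.

Lemma closure_range_cvg (I : Type) (T : topologicalType) (f : I -> T)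
    (F : set_system I) a :
  ProperFilter F -> f @ F --> a -> closure (range f) a.
Proof.
move=> FF fa B /fa FB; have [i Bi] := @filter_ex _ F _ (f @^-1` B) FB.
by exists (f i); split => //; exists i.
Qed.

Lemma cvg_near_cst_eq (I : Type) (T : topologicalType) (f : I -> T)
    (F : set_system I) a b : hausdorff_space T -> ProperFilter F ->
  f @ F --> a -> F [set i | f i = b] -> a = b.
Proof.
move=> hT FF fa fb; apply: (cvg_unique hT (F := f @ F)) => //.
exact: cvg_near_cst fb.
Qed.

(** Otherwise the complements of the finitely many residue classes all belong to [U], and their
    intersection is empty. *)
Lemma ultra_residue (U : set_system int) (d : nat) : UltraFilter U ->
  (0 < d)%N -> exists r : int, U [set m | (d %| m - r)%Z].
Proof.
move=> UU d0; apply: contrapT => /forallNP H.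
have {}H k : U [set m | forall r : nat, (r < k)%N -> ~~ (d %| m - r%:Z)%Z].
  elim: k => [|k IH]; first by apply: filterS filterT.
  have [/H//|Uk] := in_ultra_setVsetC [set m | (d %| m - k%:Z)%Z] UU.
  apply: filterS2 IH Uk => m mk /negP dm r.
  by rewrite ltnS leq_eqVlt => /predU1P[->|/mk].
have [m] := filter_ex (H d).
have dn0 : d%:Z != 0 by lia.
move/(_ `|(m %% d)%Z|%N); rewrite gez0_abs ?modz_ge0 // => /(_ _)/negP[].
  by have := @ltz_pmod m d%:Z; rewrite ltz_nat => /(_ d0); have := modz_ge0 m dn0; lia.
by rewrite {1}(divz_eq m d) addrK dvdz_mull.
Qed.

Lemma ultra_residues (U : set_system int) p : UltraFilter U ->
  fast_growing p -> exists s : nat -> int,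
    forall i, U [set m | (p i %| m - s i)%Z].
Proof.
move=> UU pf.
have H i : exists r : int, U [set m | (p i %| m - r)%Z].
  by apply: ultra_residue; rewrite // fast_growing_gt0.
by have [s sP] := choice H; exists s.
Qed.

(** * Phases of points of the orbit closure *)

(** Integer representatives of an element of the odometer, the inverse limit of the groups Z /
    [p i]. *)
Definition coherent (p : nat -> nat) (s : nat -> int) :=
  forall i, (p i %| s i.+1 - s i)%Z.

Lemma coherent_le p s i j : fast_growing p -> coherent p s -> (i <= j)%N ->
  (p i %| s j - s i)%Z.
Proof.
move=> pf sc /subnK <-; elim: (j - i)%N => [|k IH]; first by rewrite subrr.
rewrite addSn -(subrKA (s (k + i)%N)) rpredD //.
exact: fast_growing_dvdz (leq_addl k i) (sc _).
Qed.

(** Only places filled below stage [i] constrain [w]; at the holes of the phase its value is left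
    free. *)
Definition has_phase (X : Type) (p : nat -> nat) (x : nat -> X) (w : int -> X)
    (s : nat -> int) :=
  coherent p s /\
  forall i n, (level p (s i + n) < i)%N -> w n = x (level p (s i + n)).

Section Phase.
Variables (X : topologicalType) (p : nat -> nat) (x : nat -> X).
Hypotheses (hX : hausdorff_space X) (pf : fast_growing p).
Let z := oxtoby p x.

(** If [s i + n] has level below [i], then [m + n] has the same level for every [m] congruent to
    [s i] modulo [p i], so S^m z is constant at [n] along [U]. *)
Lemma ultra_phase (U : set_system int) (w : {ptws int -> X}) (s : nat -> int) :
  UltraFilter U -> (fun m => left_shiftz m z) @ U --> w ->
  (forall i, U [set m | (p i %| m - s i)%Z]) -> has_phase p x w s.
Proof.
move=> UU /ptws_cvg zw Us; split=> [i|i n il].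
  have [m [mi mi1]] := filter_ex (filterI (Us i) (Us i.+1)).
  rewrite -(subrKA m) rpredD //.
  rewrite -rpredN opprB; exact: fast_growing_dvdz (leqnSn i) mi1.
apply: (cvg_near_cst_eq hX _ (zw n)); apply: filterS (Us i) => m /= mi.
rewrite /left_shiftz /z oxtoby_level //; congr x.
by rewrite -(level_period pf mi il); congr level; lia.
Qed.

Lemma phase_exists w : orbit_closure z w -> exists s, has_phase p x w s.
Proof.
move=> /closure_range_ultra[U UU Uw]; have [s Us] := ultra_residues UU pf.
by exists s; exact: ultra_phase Us.
Qed.

Lemma oxtoby_eventually_cst i c : (forall j, (i <= j)%N -> x j = c) ->
  left_shiftz (p i) z = z.
Proof.
move=> xc; apply: funext => n; rewrite /left_shiftz /z !oxtoby_level //.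
have [il|li] := leqP i (level p n).
  by rewrite !xc // level_period_ge // dvdzz.
by rewrite (@level_period p i).
Qed.

(* A place which is a hole at stage [i] for [t] takes all the values [x j],
   [i <= j], along the progression of difference [p i]; if it is filled for
   [s], these values are all equal. *)
Lemma phase_level w s t i n : non_periodic z ->
  has_phase p x w s -> has_phase p x w t ->
  (level p (s i + n) < i)%N -> (level p (t i + n) < i)%N.
Proof.
move=> zp [sc sw] [tc tw] si; rewrite ltnNge; apply/negP => ti.
have p0 := fast_growing_gt0 i pf.
have : (p i : int) != 0 by lia.
move=> /zp; apply; apply: (@oxtoby_eventually_cst i (w n)) => j ij.
have tj : (i <= level p (t j.+1 + n))%N.
  have := level_period_ge pf (coherent_le pf tc (leqW ij)) ti.
  by rewrite addrC addrA subrK.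
have [k kj] := hole_level pf ij tj.
have sk : level p (s i + (n + k * p i)) = level p (s i + n).
  by rewrite addrA (level_period pf _ si) ?dvdz_mull.
have := @tw j.+1 (n + k * p i); rewrite addrA kj => /(_ (leqnn _)) <-.
by rewrite (@sw i) sk // -(sw i).
Qed.

(** Induction on [i]: by [phase_level], translation by [t i.+1 - s i.+1] preserves the set of places
    of level at most [i], and [level_inj_period] then lifts divisibility from [p i] to [p i.+1]. *)
Lemma phase_unique w s t i : non_periodic z ->
  has_phase p x w s -> has_phase p x w t -> (p i %| t i - s i)%Z.
Proof.
move=> zp ws wt; have [[sc _] [tc _]] := (ws, wt).
elim: i => [|i IH]; first by have [-> _ _] := pf; rewrite dvd1z.
apply: level_inj_period => // [|n]; last first.
  have := @phase_level w s t i.+1 (n - s i.+1) zp ws wt.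
  by rewrite !ltnS addrCA subrr addr0 addrCA.
rewrite -(subrKA (t i)) rpredD // -(subrKA (s i)) rpredD //.
by rewrite -rpredN opprB.
Qed.

(** Every place of z is filled at some stage, so an integer phase has no holes and determines all of
    [w]. *)
Lemma phase_integer w s (j : int) : has_phase p x w s ->
  (forall i, (p i %| s i - j)%Z) -> w = left_shiftz j z.
Proof.
move=> [sc sw] sj; apply: funext => n; rewrite /left_shiftz /z oxtoby_level //.
set i := (level p (n + j)).+1.
have E : level p (s i + n) = level p (n + j).
  rewrite -(level_period pf (sj i) (leqnn _)); congr level.
  by lia.
by rewrite (@sw i) E.
Qed.

End Phase.

(** * Sequences of places converging in the odometer *)

Section Probe.
Variables (p : nat -> nat).
Hypothesis pf : fast_growing p.

(* The places [g i] converge in the odometer and, by [probe_eq], [g i] is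
   filled at stage [i] exactly. *)
Definition probe (g : nat -> int) :=
  [/\ coherent p g, forall i, 0 <= g i < (p i)%:Z &
      forall i, (i <= level p (g i))%N].

(** Digits other than 0 and -1 keep [g i] unfilled before stage [i]. *)
Lemma probeP g : g 0%N = 0 ->
  (forall i, exists2 k : int, 1 <= k <= (p i.+1 %/ p i)%N%:Z - 2 &
     g i.+1 = g i + k * (p i)%:Z) ->
  probe g.
Proof.
move=> g0 gS.
have gb i : 0 <= g i < (p i)%:Z.
  elim: i => [|i IH]; first by rewrite g0; have [-> _ _] := pf.
  have [k + ->] := gS i; have [q q3 Eq] := fast_growingS i pf.
  rewrite Eq mulnK ?fast_growing_gt0 // PoszM => k1; nia.
split=> // i.
  by have [k _ ->] := gS i; rewrite addrAC subrr add0r dvdz_mull.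
elim: i => [//|i IH]; have [k k1 ->] := gS i.
by rewrite level_lt ?filled_at_hole // level_period_ge // dvdz_mull.
Qed.

Lemma probe_exists : exists g, probe g.
Proof.
exists (nat_rect (fun=> int) 0 (fun i c => c + 1 * (p i)%:Z)).
apply: probeP => // i; exists 1 => //.
by have [_ _ /(_ i)] := pf; lia.
Qed.

Lemma probe_level g i n : probe g -> `|n| <= (p i)%:Z ->
  (level p (g i.+1 + n) <= i.+1)%N.
Proof.
move=> [_ gb _] np; have /filled_at_near : filled_at p i.+1 (g i.+1).
  by apply: filled_at_center => //; have := gb i.+1; lia.
by move=> /(_ _ pf np)/orP[/level_le/leqW|/level_le].
Qed.

(** Each digit of [g] is chosen to have [s i.+1 + g i.+1] filled at stage [i] if possible. By
    [middle_digit] a failure means that [s i.+1 + g i] has digit 0; failing from some stage on would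
    make [s] an integer. So successes occur at arbitrarily late stages, and [filled_at_near] spreads
    them to every [n]. *)
Lemma probe_adapted s : coherent p s ->
  (forall j : int, exists i, ~~ (p i %| s i - j)%Z) ->
  exists2 g, probe g & forall n, exists j, (level p (s j + g j + n) < j)%N.
Proof.
move=> sc sj; pose P (ic : nat * int) (k : int) :=
  let: (i, c) := ic in 1 <= k <= (p i.+1 %/ p i)%N%:Z - 2 /\
   (filled_at p i (c + k * (p i)%:Z) \/
    exists b : int, b * (p i.+1)%:Z <= c < b * (p i.+1)%:Z + (p i)%:Z).
have [K KP] : exists K, forall ic, P ic (K ic).
  have H ic : exists k, P ic k by case: ic => i c; exact: middle_digit.
  by have [K KP] := choice H; exists K.
pose g := nat_rect (fun=> int) 0
  (fun i c => c + K (i, s i.+1 + c) * (p i)%:Z).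
have gS i : g i.+1 = g i + K (i, s i.+1 + g i) * (p i)%:Z by [].
have gp : probe g.
  apply: probeP => // i; exists (K (i, s i.+1 + g i)) => //.
  by have [] := KP (i, s i.+1 + g i).
exists g => // n; have [_ gb _] := gp.
have [i ni fi] : exists2 i, (`|n| < i)%N & filled_at p i (s i.+1 + g i.+1).
  apply: contrapT => H.
  have {}H i : (`|n| < i)%N -> exists b : int,
      b * (p i.+1)%:Z <= s i.+1 + g i < b * (p i.+1)%:Z + (p i)%:Z.
    move=> ni; have [_ []//] := KP (i, s i.+1 + g i).
    by rewrite -addrA -gS => fi; case: H; exists i.
  pose i0 := `|n|.+1%N.
  (* If no digit were hit, [s] would be the integer [j], the carry-free
     difference between the residues of [s i + g i] and [g i]. *)
  have [j jP] : exists j : int, forall i, (i0 <= i)%N ->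
      (p i.+1 %| s i.+1 - j)%Z /\ 0 <= j + g i < (p i)%:Z.
    have [b bP] := H i0 (leqnn _).
    exists (s i0.+1 - b * (p i0.+1)%:Z) => i /subnK <-.
    elim: (i - i0)%N => [|m [IH1 IH2]].
      by rewrite add0n; split; [rewrite subKr dvdz_mull | lia].
    rewrite addSn; move: IH1 IH2.
    set j := s i0.+1 - _; set l := (m + i0)%N => IH1 IH2.
    have [b' b'P] : exists b' : int, b' * (p l.+2)%:Z <= s l.+2 + g l.+1
        < b' * (p l.+2)%:Z + (p l.+1)%:Z by apply: H; rewrite /l /i0; lia.
    have h3 : 0 <= j + g l.+1 < (p l.+1)%:Z.
      rewrite gS; have [+ _] := KP (l, s l.+1 + g l).
      set k := K _ => k1; have [q q3 Eq] := fast_growingS l pf.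
      move: k1; rewrite Eq mulnK ?fast_growing_gt0 // PoszM => k1; nia.
    split=> //; suff -> : s l.+2 - j = b' * (p l.+2)%:Z by rewrite dvdz_mull.
    have /dvdzP[u Hu] := sc l.+1; have /dvdzP[v Hv] := IH1.
    have [q q3 Eq] := fast_growingS l.+1 pf; move: b'P; rewrite Eq PoszM => b'P.
    have pZ := fast_growing_gt0 l.+1 pf.
    (* Here [s l.+2 - j] is [(u + v) * p l.+1]. Modulo the shift by [b' * p l.+2], both
       [s l.+2 + g l.+1] and [j + g l.+1] lie in [[0, p l.+1)], so the integer [u + v - b' * q] has
       absolute value below 1. *)
    have h4 : (u + v - b' * q) * (p l.+1)%:Z < 1 * (p l.+1)%:Z by lia.
    have h5 : -1 * (p l.+1)%:Z < (u + v - b' * q) * (p l.+1)%:Z by lia.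
    move: h4 h5; rewrite !ltr_pM2r // => h4 h5.
    have : u + v = b' * q by lia.
    by move=> /(congr1 ( *%R^~ (p l.+1)%:Z)); lia.
  have [i /negP[]] := sj j; have [dj _] := jP (maxn i i0) (leq_maxr _ _).
  have im : (i <= (maxn i i0).+1)%N by rewrite leqW ?leq_maxl.
  rewrite -(subrKA (s (maxn i i0).+1)) rpredD //.
    by rewrite -rpredN opprB coherent_le.
  exact: fast_growing_dvdz im dj.
case: i ni fi => // i ni fi; exists i.+2.
have np : `|n| <= (p i)%:Z by have := fast_growing_gt i pf; lia.
by have /orP[/level_le/leqW|/level_le] := filled_at_near pf np fi.
Qed.
End Probe.

Lemma increasing_seq_infl (u : nat -> nat) k : increasing_seq u -> (k <= u k)%N.
Proof.
move=> uP; elim: k => // k IH; apply: leq_ltn_trans IH _.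
by rewrite ltnNge; have := uP k.+1 k; rewrite !leEnat => ->; rewrite ltnn.
Qed.

Lemma probe_eq (p : nat -> nat) g i : fast_growing p -> probe p g ->
  level p (g i) = i.
Proof.
move=> pf [_ gb gl]; apply/eqP; rewrite eqn_leq gl andbT level_le //.
by apply: filled_at_center => //; have := gb i; lia.
Qed.

(** A place filled for the limit phase [g] is eventually constant. At a hole [n] the level of
    [g (u k) + n] is eventually [u k] itself, by [probe_level], so the values follow [x \o u]. *)
Lemma probe_cvg (X : topologicalType) (p : nat -> nat) (x : nat -> X) g
    (u : nat -> nat) (l : X) :
  fast_growing p -> probe p g -> increasing_seq u -> x \o u @ \oo --> l ->
  exists v : {ptws int -> X},
    (fun k => left_shiftz (g (u k)) (oxtoby p x)) @ \oo --> v.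
Proof.
move=> pf gp uP xl; have [gc _ _] := gp.
have H (n : int) : exists a : X, x (level p (g (u k) + n)) @[k --> \oo] --> a.
  have [[j jl]|] := pselect (exists j, (level p (g j + n)%R < j)%N).
    exists (x (level p (g j + n))); apply: cvg_near_cst.
    exists j => // k /= jk; congr x.
    have ju := leq_trans jk (increasing_seq_infl k uP).
    by rewrite -(level_period pf (coherent_le pf gc ju) jl); congr level; lia.
  move=> /forallNP nj; exists l; apply: cvg_trans xl; apply: near_eq_cvg.
  exists `|n|.+1%N => // k /= nk.
  have := leq_trans nk (increasing_seq_infl k uP).
  case E : (u k) => [//|i] ni; congr x.
  apply/eqP; rewrite eqn_leq probe_level //; last first.
    by have := fast_growing_gt i pf; lia.
  by have /negP := nj i.+1; rewrite -leqNgt => ->.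
have [v vP] := choice H; exists (v : {ptws int -> X}); apply/ptws_cvg => n.
have -> : (fun k => left_shiftz (g (u k)) (oxtoby p x) n) =
    (fun k => x (level p (g (u k) + n))); last exact: vP.
by apply: funext => k; rewrite /left_shiftz oxtoby_level // addrC.
Qed.

(** * Transport of convergence along a factor map *)

Lemma cvg_set_val (T : topologicalType) (A : set T) (I : Type)
    (F : set_system I) (f : I -> A) (v : A) : Filter F ->
  (fun i => set_val (f i)) @ F --> set_val v -> f @ F --> v.
Proof.
move=> FF fv B /= [_ [[C oC <-] Cv] CB].
have /fv FC : nbhs (set_val v) C by rewrite nbhsE; exists C.
exact: (@filterS _ F _ (fun i => C (set_val (f i))) _ (fun i => @CB (f i)) FC).
Qed.

Lemma continuous_set_val (T : topologicalType) (A : set T) :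
  continuous (set_val : A -> T).
Proof. exact: initial_continuous. Qed.

Section Shift.
Variable X : topologicalType.
Implicit Types z w v : {ptws int -> X}.

Lemma left_shiftzD a b z :
  left_shiftz a (left_shiftz b z) = left_shiftz (a + b) z.
Proof. by apply: funext => n; rewrite /left_shiftz addrA. Qed.

Lemma cvg_left_shiftz (I : Type) (F : set_system I) (f : I -> {ptws int -> X})
    (l : {ptws int -> X}) (a : int) : Filter F ->
  f @ F --> l -> (fun i => left_shiftz a (f i)) @ F --> left_shiftz a l.
Proof. by move=> FF /ptws_cvg fl; apply/ptws_cvg => n; exact: fl. Qed.

Lemma orbit_closure_left_shiftz z w a :
  orbit_closure z w -> orbit_closure z (left_shiftz a w).
Proof.
move=> /closure_range_ultra[U UU /(@cvg_left_shiftz _ U _ _ a _) Uw].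
have sub : range (fun m => left_shiftz a (left_shiftz m z)) `<=`
    range (fun m => left_shiftz m z).
  by move=> _ [m _ <-]; exists (a + m) => //; rewrite left_shiftzD.
exact: (@closure_subset {ptws int -> X} _ _ sub _ (closure_range_cvg _ Uw)).
Qed.

End Shift.

Section Factor.
Variables (X : topologicalType) (z z' : {ptws int -> X}).
Variable k : orbit_closure z' -> orbit_closure z.
Hypothesis k_continuous : continuous k.
Hypothesis k_shift :
  forall y, k (orbit_closure_shift y) = orbit_closure_shift (k y).

(** Relating two points avoids iterating S on the subtype, and reduces negative [m] to positive [m]
    with [y] and [y'] exchanged. *)
Lemma factor_left_shiftz (m : int) (y y' : orbit_closure z') :
  set_val y' = left_shiftz m (set_val y) ->
  set_val (k y') = left_shiftz m (set_val (k y)).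
Proof.
have Hn (n : nat) a b : set_val b = left_shiftz n (set_val a :> {ptws int -> X}) ->
    set_val (k b) = left_shiftz n (set_val (k a)).
  elim: n a => [|n IH] a ba.
    by rewrite left_shiftz0 in ba; rewrite (val_inj ba) left_shiftz0.
  have E t : left_shiftz n.+1 t = left_shiftz n (left_shift t) :> {ptws int -> X}.
    by rewrite -addn1 PoszD -left_shiftzD.
  by rewrite !E in ba *; rewrite (IH (orbit_closure_shift a) ba) k_shift.
case: m => [n|n] yy'; first exact: Hn.
have -> : set_val (k y) = left_shiftz n.+1 (set_val (k y')).
  by apply: Hn; rewrite yy' left_shiftzD NegzE addrN left_shiftz0.
by rewrite left_shiftzD NegzE addNr left_shiftz0.
Qed.

(** The limit [v] stays in the closed set [orbit_closure z'], so continuity of [k] applies there. *)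
Lemma factor_shift_cvg (I : Type) (F : set_system I) (a : I -> int)
    (w : orbit_closure z') (v : {ptws int -> X}) : ProperFilter F ->
  (fun i => left_shiftz (a i) (set_val w)) @ F --> v ->
  exists v' : {ptws int -> X},
    (fun i => left_shiftz (a i) (set_val (k w))) @ F --> v'.
Proof.
move=> FF wv.
have zw i : orbit_closure z' (left_shiftz (a i) (set_val w)).
  by apply: orbit_closure_left_shiftz; exact: set_valP.
have zv : orbit_closure z' v.
  apply: (closed_cvg (orbit_closure z') _ _ _ wv); first exact: closed_closure.
  exact: nearW.
pose y i : orbit_closure z' := SigSub (mem_set (zw i)).
have yv : y @ F --> (SigSub (mem_set zv) : orbit_closure z').
  exact: cvg_set_val.
exists (set_val (k (SigSub (mem_set zv)))).
have -> : (fun i => left_shiftz (a i) (set_val (k w))) =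
    (fun i => set_val (k (y i))).
  by apply: funext => i; apply/esym/factor_left_shiftz.
apply: (cvg_comp (fun i => k (y i)) set_val) (@continuous_set_val _ _ _).
exact: (cvg_comp y k yv (@k_continuous _)).
Qed.

End Factor.

(* If the phase [s] of the point [w] above [z] is not an integer, probes can be
   chosen along which [w] converges whatever [x'] is, so that [x] converges. *)
Lemma oxtoby_factor_cvg (X : topologicalType) (p : nat -> nat)
    (x x' : nat -> X)
    (k : orbit_closure (oxtoby p x') -> orbit_closure (oxtoby p x))
    (w : orbit_closure (oxtoby p x')) (u : nat -> nat) :
  hausdorff_space X -> fast_growing p -> continuous k ->
  (forall y, k (orbit_closure_shift y) = orbit_closure_shift (k y)) ->
  set_val (k w) = oxtoby p x -> increasing_seq u ->
  (exists l : X, x' \o u @ \oo --> l) -> exists l : X, x \o u @ \oo --> l.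
Proof.
move=> hX pf kc kS kw uP [l x'l].
have [s ws] := phase_exists hX pf (set_valP w).
have [[j sj]|ns] := pselect (exists j : int, forall i, (p i %| s i - j)%Z).
  have wE : set_val w = left_shiftz j (oxtoby p x') := phase_integer pf ws sj.
  have [g gp] := probe_exists pf.
  have [v gv] := probe_cvg pf gp uP x'l.
  have wv : (fun k => left_shiftz (g (u k) - j) (set_val w)) @ \oo --> v.
    apply: cvg_trans gv; apply: near_eq_cvg; apply: nearW => i /=.
    by rewrite wE left_shiftzD subrK.
  (* Shifted by [g (u i) - j] and read at place [j], z gives its value at [g (u i)], which is
     [x (u i)]. *)
  have [v'] := factor_shift_cvg kc kS _ wv; rewrite kw => /ptws_cvg/(_ j) zv'.
  exists (v' j); move: zv'; rewrite /left_shiftz.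
  have -> // : (fun i => oxtoby p x (j + (g (u i) - j))) = x \o u.
  by apply: funext => i; rewrite addrC subrK oxtoby_level // (probe_eq _ pf gp).
have [sc sw] := ws.
have [j|g gp gl] := probe_adapted pf sc.
  apply: contrapT => /forallNP H; apply: ns; exists j => i.
  by apply: contrapT => /negP; exact: H.
have [gc _ _] := gp.
(* The phase [s + g] has no hole, so every place is eventually constant. *)
have H (n : int) : exists a : X, left_shiftz (g i) (set_val w) n @[i --> \oo] --> a.
  have [j jl] := gl n; exists (x' (level p (s j + g j + n))).
  apply: cvg_near_cst; exists j => // i /= ji.
  have E : level p (s j + (n + g i)) = level p (s j + g j + n).
    rewrite -(level_period pf (coherent_le pf gc ji) jl); congr level; lia.
  by have := sw j (n + g i); rewrite E => /(_ jl).
have [v vP] := choice H.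
have /(factor_shift_cvg kc kS _)[v'] :
  (fun i => left_shiftz (g i) (set_val w)) @ \oo --> (v : {ptws int -> X}).
  by apply/ptws_cvg.
rewrite kw => /ptws_cvg/(_ 0); rewrite /left_shiftz.
have -> : (fun i => oxtoby p x (0 + g i)) = x.
  by apply: funext => i; rewrite add0r oxtoby_level // (probe_eq _ pf gp).
(* In this case the whole sequence [x] converges, hence so does [x \o u]. *)
move=> xv'; exists (v' 0) => A /xv'[N _ NA]; exists N => // i /= Ni.
by apply: NA => /=; exact: leq_trans Ni (increasing_seq_infl i uP).
Qed.

(** * From the topological type to a conjugacy *)

(** Pick increasing stages alternately along [F] and [G], with [x] ever closer to [c] and [x'] to
    [a] or [b]. Then [x] converges along them, hence so does [x'], and its even and odd subsequences
    give the same limit. *)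
Lemma same_topological_type_limit (R : realType) (X : metricType R)
    (x x' : nat -> X) (F G : set_system nat) (c a b : X) :
  same_topological_type x x' -> ProperFilter F -> ProperFilter G ->
  F --> \oo -> G --> \oo ->
  x @ F --> c -> x @ G --> c -> x' @ F --> a -> x' @ G --> b -> a = b.
Proof.
move=> xx' FF GF Foo Goo xF xG x'F x'G.
pose d k := if odd k then b else a.
pose P (kN : nat * nat) i := [/\ (kN.2 <= i)%N,
  ball c (kN.1.+1%:R^-1 : R) (x i) & ball (d kN.1) (kN.1.+1%:R^-1 : R) (x' i)].
have PE H l kN : ProperFilter H -> H --> \oo -> x @ H --> c -> x' @ H --> l ->
    d kN.1 = l -> exists i, P kN i.
  move=> HF Hoo /cvg_ballP Hx /cvg_ballP Hx' dl.
  have e0 : 0 < (kN.1.+1%:R^-1 : R) by rewrite invr_gt0 ltr0n.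
  have HN : H [set i | (kN.2 <= i)%N] by apply: Hoo; exists kN.2.
  have [i [[Ni xi] x'i]] := filter_ex (filterI (filterI HN (Hx _ e0)) (Hx' _ e0)).
  by exists i; split => //; rewrite dl.
have [f fP] : exists f, forall kN, P kN (f kN).
  suff H kN : exists i, P kN i by have [f fP] := choice H; exists f.
  by case E : (odd kN.1); [apply: (PE G b) | apply: (PE F a)] => //; rewrite /d E.
(* The second argument of [f] is the previous stage plus one, which makes [u] strictly
   increasing. *)
pose u := nat_rect (fun=> nat) (f (0%N, 0%N)) (fun k i => f (k.+1, i.+1)).
have uP : increasing_seq u.
  by apply/increasing_seqP => k; have [] := fP (k.+1, (u k).+1).
have uxx' k : ball c (k.+1%:R^-1 : R) (x (u k)) /\
    ball (d k) (k.+1%:R^-1 : R) (x' (u k)).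
  by case: k => [|k]; [have [] := fP (0%N, 0%N) | have [] := fP (k.+1, (u k).+1)].
have small (e : R) : 0 < e -> exists N, forall k, (N <= k)%N -> k.+1%:R^-1 < e.
  by move=> e0; have [N _ NP] := near_infty_natSinv_lt (PosNum e0); exists N.
have xc : x \o u @ \oo --> c.
  apply/cvg_ballP => e /small[N NP]; exists N => // k /= /NP ke.
  by apply: le_ball (ltW ke) _ _; have [] := uxx' k.
have [l x'l] := (xx' u uP).1 (ex_intro _ c xc).
have dl (e : bool) : l = d e.
  have lim : x' (u (e + k.*2)%N) @[k --> \oo] --> l.
    by move=> A /x'l[N _ NA]; exists N => // k /= Nk; apply: NA => /=; lia.
  have lim' : x' (u (e + k.*2)%N) @[k --> \oo] --> d e.
    apply/cvg_ballP => eps /small[N NP]; exists N => // k /= Nk.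
    have -> : d e = d (e + k.*2)%N by rewrite /d oddD odd_double addbF; case: e {lim}.
    by have [_] := uxx' (e + k.*2)%N; apply: le_ball; apply/ltW/NP; lia.
  refine (@cvg_unique _ (@metric_hausdorff _ X) _ _ _ _ lim lim').
by rewrite -[a]/(d false) -[b]/(d true) -!dl.
Qed.

(** If [h] failed at [y], compactness would give a cluster point of [h] along points near [y] sent
    outside [B]; the closed graph makes it [h y], which is interior to [B]. *)
Lemma closed_graph_continuous (S T : topologicalType) (h : S -> T) :
  compact [set: T] -> closed [set st | st.2 = h st.1] -> continuous h.
Proof.
move=> cT hG y B hB; apply: contrapT => nB.
pose F := within (~` (h @^-1` B)) (nbhs y).
have FF : ProperFilter F.
  apply: Build_ProperFilter_ex => A FA.
  have {}FA : nbhs y [set s | ~ B (h s) -> A s] := FA.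
  apply: contrapT => nA; apply: nB; apply: filterS FA => s sA.
  by apply: contrapT => nBs; apply: nA; exists s; exact: sA.
have hF : ProperFilter (h @ F) by exact: fmap_proper_filter.
have [y' [_ hy']] := cT _ hF filterT.
have /= y'E : [set st | st.2 = h st.1] (y, y').
  apply: hG => W [[A C] /= [yA y'C] sW].
  have [|t [[s As st] Ct]] := hy' (h @` A) C _ y'C.
    have : nbhs y A := yA.
    by apply: filterS => s As _; exists s.
  by exists (s, t); split => //; exact: sW.
have FB : (h @ F) (~` B) by apply: (@filterS _ (nbhs y) _ setT _ _ filterT).
by have [|t []//] := hy' (~` B) B FB; rewrite y'E.
Qed.

Definition orbit_joining (X : topologicalType) (z z' : {ptws int -> X}) :
    set ({ptws int -> X} * {ptws int -> X}) :=
  closure (range (fun m => (left_shiftz m z, left_shiftz m z'))).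

Section Joining.
Variables (X : topologicalType) (z z' : {ptws int -> X}).
Implicit Types y : {ptws int -> X}.

Lemma orbit_joining_sym y y' :
  orbit_joining z z' (y, y') -> orbit_joining z' z (y', y).
Proof.
move=> yy' W [[A B] /= [yA y'B] sW].
have [|_ [[m _ <-] [/= Bm Am]]] := yy' (B `*` A); first by exists (B, A).
by exists (left_shiftz m z', left_shiftz m z); split; [exists m | exact: sW].
Qed.

Lemma orbit_joining_fst y y' : orbit_joining z z' (y, y') -> orbit_closure z y.
Proof.
move=> yy' A yA.
have [|_ [[m _ <-] [/= Am _]]] := yy' (A `*` setT).
  by exists (A, setT) => //; split => //; exact: filterT.
by exists (left_shiftz m z); split => //; exists m.
Qed.

(** Along an ultrafilter with S^m z tending to [y], compactness gives S^m z' a cluster point. *)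
Lemma orbit_joining_total y : compact [set: X] ->
  orbit_closure z y -> exists y', orbit_joining z z' (y, y').
Proof.
move=> cX /closure_range_ultra[U UU Uy].
have UF : ProperFilter ((fun m => left_shiftz m z') @ U).
  exact: fmap_proper_filter.
have [y' [_ Uy']] := compact_ptws cX UF filterT.
exists y' => W [[A B] /= [yA y'B] sW].
have [|_ [[m Am <-] Bm]] := Uy' ((fun m => left_shiftz m z') @`
   ((fun m => left_shiftz m z) @^-1` A)) B _ y'B.
  have UA : U ((fun m => left_shiftz m z) @^-1` A) := Uy _ yA.
  by apply: (@filterS _ U _ _ _ _ UA) => m Am; exists m.
exists (left_shiftz m z, left_shiftz m z'); split; first by exists m.
exact: sW.
Qed.

Lemma orbit_joining_shift y y' : orbit_joining z z' (y, y') ->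
  orbit_joining z z' (left_shift y, left_shift y').
Proof.
move=> yy' W [[A B] /= [yA y'B] sW].
have [|_ [[m _ <-] [/= Am Bm]]] :=
    yy' ((@left_shift X @^-1` A) `*` (@left_shift X @^-1` B)).
  by exists (@left_shift X @^-1` A, @left_shift X @^-1` B) => //;
    split; exact: continuous_left_shift.
exists (left_shiftz (m + 1) z, left_shiftz (m + 1) z'); split.
  by exists (m + 1).
by apply: sW; rewrite !left_shiftzS.
Qed.

End Joining.

Definition joining_functional (X : topologicalType) (z z' : {ptws int -> X}) :=
  forall y y1 y2 : {ptws int -> X}, orbit_joining z z' (y, y1) ->
  orbit_joining z z' (y, y2) -> y1 = y2.

Lemma joining_map (X : topologicalType) (z z' : {ptws int -> X}) :
  compact [set: X] -> joining_functional z z' ->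
  exists2 h : orbit_closure z -> orbit_closure z', continuous h &
    forall y, orbit_joining z z' (set_val y, set_val (h y)).
Proof.
move=> cX zz'.
have H (y : orbit_closure z) : exists y' : orbit_closure z',
    orbit_joining z z' (set_val y, set_val y').
  have [y' yy'] := orbit_joining_total z' cX (set_valP y).
  have zy' := orbit_joining_fst (orbit_joining_sym yy').
  by exists (SigSub (mem_set zy')).
have [h hP] := choice H; exists h => //.
(* The codomain is enlarged to the full sequence space, which is compact; [cvg_set_val] restricts it
   again. *)
have hc : continuous (fun y => set_val (h y)).
  apply: closed_graph_continuous; first exact: compact_ptws.
  have -> : [set yy' | yy'.2 = set_val (h yy'.1)] =
     (fun yy' : orbit_closure z * {ptws int -> X} => (set_val yy'.1, yy'.2))
       @^-1` orbit_joining z z'.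
    rewrite eqEsubset; split=> -[y y'] /= => [->|]; first exact: hP.
    by move=> /zz'; apply; exact: hP.
  refine (preimage_closed _ (@closed_closure _ _)) => -[y y'] _.
  move=> W [[A C] /= [yA y'C] sW]; exists (set_val @^-1` A, C).
    by split=> //; exact: (@continuous_set_val _ _ y A).
  by move=> [a b] [/= Aa Cb]; exact: sW.
by move=> y; exact: cvg_set_val (hc y).
Qed.

(** Both inverse laws and equivariance follow from uniqueness, the joining being symmetric and
    shift-invariant. *)
Lemma joining_conjugate (X : topologicalType) (z z' : {ptws int -> X}) :
  compact [set: X] -> joining_functional z z' -> joining_functional z' z ->
  conjugate (@orbit_closure_shift X z) (@orbit_closure_shift X z').
Proof.
move=> cX zz' z'z.
have [h hc hP] := joining_map cX zz'; have [k kc kP] := joining_map cX z'z.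
exists h; split; [split => //; exists k; split => // y|move=> y /=]; apply: val_inj.
- exact: (z'z _ _ _ (kP _) (orbit_joining_sym (hP _))).
- exact: (zz' _ _ _ (hP _) (orbit_joining_sym (kP _))).
- exact: (zz' _ _ _ (hP (orbit_closure_shift y)) (orbit_joining_shift (hP y))).
Qed.

Lemma oxtoby_joining_functional (R : realType) (X : metricType R)
    (p : nat -> nat) (x x' : nat -> X) : fast_growing p ->
  non_periodic (oxtoby p x) -> same_topological_type x x' ->
  joining_functional (oxtoby p x) (oxtoby p x').
Proof.
move=> pf zp xx' y y1 y2.
move=> /closure_range_ultra[U UU Uy] /closure_range_ultra[V VV Vy].
have hX := @metric_hausdorff _ X.
have [s Us] := ultra_residues UU pf; have [t Vt] := ultra_residues VV pf.
have {}Uy : (fun m => left_shiftz m (oxtoby p x)) @ U --> y /\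
    (fun m => left_shiftz m (oxtoby p x')) @ U --> y1.
  by split; [apply: (cvg_comp _ _ Uy cvg_fst)|apply: (cvg_comp _ _ Uy cvg_snd)].
have {}Vy : (fun m => left_shiftz m (oxtoby p x)) @ V --> y /\
    (fun m => left_shiftz m (oxtoby p x')) @ V --> y2.
  by split; [apply: (cvg_comp _ _ Vy cvg_fst)|apply: (cvg_comp _ _ Vy cvg_snd)].
have [[Uy0 Uy1] [Vy0 Vy2]] := (Uy, Vy).
(* Both ultrafilters yield phases of the same point [y]. *)
have ts i : (p i %| t i - s i)%Z.
  exact: (phase_unique pf i zp (ultra_phase hX pf UU Uy0 Us)
    (ultra_phase hX pf VV Vy0 Vt)).
have [_ y1P] := ultra_phase hX pf UU Uy1 Us.
have [_ y2P] := ultra_phase hX pf VV Vy2 Vt.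
apply: funext => n.
have [[i si]|/forallNP sn] := pselect (exists i, (level p (s i + n) < i)%N).
  have ti : level p (t i + n) = level p (s i + n).
    by rewrite -(level_period pf (ts i) si); congr level; lia.
  by rewrite (y1P i) // (y2P i) ?ti.
have sl N : (N <= level p (s N + n))%N.
  by rewrite leqNgt; apply/negP; exact: sn.
have tl N : (N <= level p (t N + n))%N.
  have := level_period_ge pf (ts N) (sl N); rewrite (_ : _ + _ + _ = t N + n) //.
  lia.
(* At a hole [n], [f m] is the stage read by S^m z. The images of [U] and [V] under [f] tend to
   infinity, and [x] has the limit [y n] along both. *)
pose f m := level p (n + m).
have lim W (r : nat -> int) q (l : {ptws int -> X}) : UltraFilter W ->
  (forall i, W [set m | (p i %| m - r i)%Z]) ->
  (fun m => left_shiftz m (oxtoby p q)) @ W --> l -> q @ (f @ W) --> l n.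
  move=> WW Wr /ptws_cvg/(_ n); rewrite /left_shiftz.
  have -> // : (fun m => oxtoby p q (n + m)) = q \o f.
  by apply: funext => m; rewrite oxtoby_level.
have foo W (r : nat -> int) : UltraFilter W ->
  (forall i, W [set m | (p i %| m - r i)%Z]) ->
  (forall N, (N <= level p (r N + n))%N) -> f @ W --> \oo.
  move=> WW Wr rl A [N _ NA]; apply: (@filterS _ W _ _ _ _ (Wr N)) => m /= mN.
  apply: NA => /=.
  have := level_period_ge pf mN (rl N); rewrite /f.
  by rewrite (_ : _ + _ + _ = n + m) //; lia.
have Uf : ProperFilter (f @ U) by exact: fmap_proper_filter.
have Vf : ProperFilter (f @ V) by exact: fmap_proper_filter.
exact: (same_topological_type_limit xx' Uf Vf (foo _ _ UU Us sl)
  (foo _ _ VV Vt tl) (lim _ _ _ _ UU Us Uy0) (lim _ _ _ _ VV Vt Vy0)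
  (lim _ _ _ _ UU Us Uy1) (lim _ _ _ _ VV Vt Vy2)).
Qed.

Lemma orbit_closure_self (X : topologicalType) (z : {ptws int -> X}) :
  orbit_closure z z.
Proof. by apply: subset_closure; exists 0 => //; rewrite left_shiftz0. Qed.

Local Close Scope ring_scope.

Theorem theorem7p1 (R : realType) (X : metricType R)
  (hX : compact [set: X]) (x x' : nat -> X) (p : nat -> nat)
  (hp : fast_growing p)
  (hz : non_periodic (oxtoby p x)) (hz' : non_periodic (oxtoby p x')) :
  conjugate (@orbit_closure_shift X (oxtoby p x))
            (@orbit_closure_shift X (oxtoby p x'))
  <-> same_topological_type x x'.
Proof.
have hausX := @metric_hausdorff _ X.
split=> [[h [[hc [k [hk kh kc]]] hS]] u uP|xx']; last first.
  apply: joining_conjugate => //; apply: oxtoby_joining_functional => //.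
  by move=> u uP; apply: iff_sym; exact: xx'.
have kS y : k (orbit_closure_shift y) = orbit_closure_shift (k y).
  by rewrite -{1}[y]kh; have /= <- := hS (k y); rewrite hk.
split.
  (* The point sent by [h] to z' is its image under the inverse [k]. *)
  apply: (@oxtoby_factor_cvg X p x' x h
    (k (SigSub (mem_set (@orbit_closure_self X (oxtoby p x')))))) => //.
  by rewrite kh.
apply: (@oxtoby_factor_cvg X p x x' k
  (h (SigSub (mem_set (@orbit_closure_self X (oxtoby p x)))))) => //.
by rewrite hk.
Qed.
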